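(* Let $\mathrm{H}$ be a finite group and $\sigma\in\mathrm{Aut}(\mathrm{H})$ with $\sigma^2=\mathrm{Id}$. If $\mathcal{G}_{\mathrm{TF}}(\mathrm{H},\sigma)=|\mathrm{H}|$, then there exists $k\in\mathbb{Z}_{\ge0}$ such that $\mathrm{H}\cong\mathbb{Z}_2^k$ and $\sigma=\mathrm{Id}$.
   Context: $\mathbb{Z}_2=\{e,x\}$, $\mathrm{H}\rtimes_\theta\mathbb{Z}_2$ is the semidirect product with $\theta(x)=\sigma$ (so $xhx=\sigma(h)$), $\mathrm{H}$ is identified with $\mathrm{H}\times\{e\}$; $S(\mathrm{H},\sigma)$ is the set of $g\in\mathrm{H}\rtimes_\theta\mathbb{Z}_2$ with $g\notin\mathrm{H}$ and $g^2=e$; $\mathcal{G}_{\mathrm{TF}}(\mathrm{H},\sigma)$ is the number of conjugacy classes of $\mathrm{H}\rtimes_\theta\mathbb{Z}_2$ contained in $S(\mathrm{H},\sigma)$. *)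

(* Defs.v *)
From HB Require Import structures.
From mathcomp Require Import all_boot all_algebra all_fingroup.

Set Implicit Arguments.
Unset Strict Implicit.
Unset Printing Implicit Defensive.

Import GroupScope.

Section TwistedInvolutions.

Variables (gT : finGroupType) (H : {group gT}) (sigma : {perm gT}).
Hypotheses (AutHsigma : sigma \in Aut H) (sigma2 : sigma ^+ 2 = 1).

(* 'Z_2 carries its additive group law, so its neutral element e is 0 and its *)
(* generator x is 1.                                                          *)
Definition theta (i : 'Z_2) : {perm gT} := sigma ^+ i.

Lemma theta_morphM : {in [set: 'Z_2] &, {morph theta : i j / i * j}}.
Proof.
by move=> i j _ _; rewrite /theta -expgD [LHS](expg_mod _ sigma2).
Qed.

Definition theta_act (h : gT) (i : 'Z_2) : gT := theta i h.

Lemma theta_is_action : is_action [set: 'Z_2] theta_act.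
Proof.
split=> [i|h i j Di Dj]; first exact: perm_inj.
by rewrite /theta_act theta_morphM // permM.
Qed.

Definition theta_action := Action theta_is_action.

Lemma theta_is_groupAction : is_groupAction H theta_action.
Proof.
move=> i _; rewrite (_ : actperm _ i = theta i) ?groupX //.
by apply/permP=> h; rewrite actpermE.
Qed.

Definition theta_gact : groupAction [set: 'Z_2] H :=
  GroupAction theta_is_groupAction.

Definition sdHZ2 : finGroupType := sdprod_by theta_gact.

Definition sdH : {set sdHZ2} := sdpair1 theta_gact @* H.

Definition sdx : sdHZ2 := sdpair2 theta_gact 1%R.

Lemma sdx_conj (h : gT) : h \in H ->
  sdx * sdpair1 theta_gact h * sdx = sdpair1 theta_gact (sigma h).
Proof.
move=> Hh; have Dx : (1%R : 'Z_2) \in [set: 'Z_2] by rewrite inE.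
have x2 : sdx * sdx = 1.
  by rewrite -morphM // (_ : (1%R : 'Z_2) * (1%R : 'Z_2) = 1) ?morph1 //; apply: val_inj.
have -> : sigma h = theta_gact h 1%R by rewrite /= /theta_act /theta expg1.
by rewrite sdpair_act // /conjg -/sdx -mulgA -[sdx^-1]mulg1 -x2 mulKg.
Qed.

Definition S_TF : {set sdHZ2} := [set g | (g \notin sdH) && (g ^+ 2 == 1)].

Definition G_TF : nat := #|[set C in classes [set: sdHZ2] | C \subset S_TF]|.

End TwistedInvolutions.

(* Main.v *)
(** The classes contained in [S_TF] are disjoint nonempty subsets of the coset
    [H x], which has [#|H|] elements. If there are [#|H|] of them, then every
    element of [H x] is a central involution. Centrality of [x] gives
    [sigma = 1], and then [(h x)^2 = 1] and the centrality of [h x] show that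
    [H] is an elementary abelian 2-group. *)
Require Import Defs.
From mathcomp Require Import all_boot all_algebra all_fingroup all_solvable mxabelem.

Set Implicit Arguments.
Unset Strict Implicit.
Unset Printing Implicit Defensive.

Import GroupScope.

Section ClassesInSet.

Variables (gT : finGroupType) (G : {group gT}) (A : {set gT}).

Let P := [set C in classes G | C \subset A].

Lemma mem_repr_classes C : C \in classes G -> repr C \in C.
Proof. by case/imsetP=> x _ ->; apply: mem_repr (class_refl G x). Qed.

Lemma repr_classes_inj : {in classes G &, injective (@repr gT)}.
Proof.
move=> _ _ /imsetP[x Gx ->] /imsetP[y Gy ->] eq_xy.
have /class_eqP <- := mem_repr _ (class_refl G x).
by rewrite eq_xy; apply/class_eqP/(mem_repr _ (class_refl G y)).
Qed.

Lemma repr_classes_sub : [set repr C | C in P] \subset A.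
Proof.
apply/subsetP=> _ /imsetP[C /setIdP[clC /subsetP sCA] ->].
exact/sCA/mem_repr_classes.
Qed.

Lemma card_repr_classes : #|[set repr C | C in P]| = #|P|.
Proof.
apply: card_in_imset => C D /setIdP[clC _] /setIdP[clD _].
exact: repr_classes_inj.
Qed.

Lemma card_classes_sub : #|P| <= #|A|.
Proof. by rewrite -card_repr_classes subset_leq_card ?repr_classes_sub. Qed.

(** Equality case of the count: [repr] injects [P] into [A], so it is now onto, and no class in [P]
    has room for a second element. *)
Lemma classes_sub_cent : #|A| <= #|P| -> A \subset 'C(G).
Proof.
move=> leAP; have defA : [set repr C | C in P] = A.
  by apply/eqP; rewrite eqEcard repr_classes_sub card_repr_classes.
have reprA a : a \in A -> a ^: G \subset A /\ repr (a ^: G) = a.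
  rewrite -{1}defA => /imsetP[C /setIdP[clC sCA] def_a].
  have aC : a \in C by rewrite def_a mem_repr_classes.
  case/imsetP: clC => y Gy defC; move: aC; rewrite defC => /class_eqP ->.
  by rewrite -defC.
apply/subsetP=> a Aa; apply/centP=> g Gg; apply/commgP/conjg_fixP.
have [/subsetP sA ra] := reprA a Aa.
(* The conjugate [a ^ g] also lies in [A] and has the same class as [a], so both equal the one
   representative of that class. *)
have [_ <-] := reprA _ (sA _ (memJ_class a Gg)).
by rewrite classGidl.
Qed.

End ClassesInSet.

Section SemidirectZ2.

Variables (gT : finGroupType) (H : {group gT}) (sigma : {perm gT}).
Hypotheses (AutHsigma : sigma \in Aut H) (sigma2 : sigma ^+ 2 = 1).

Let to := theta_gact AutHsigma sigma2.
Let K := sdH AutHsigma sigma2.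
Let x := sdx AutHsigma sigma2.

Lemma card_sdH : #|K| = #|H|.
Proof. by rewrite [LHS](card_injm (injm_sdpair1 to)). Qed.

Lemma card_sdHC : #|~: K| = #|H|.
Proof.
apply/eqP; rewrite -(eqn_add2l #|K|) cardsC card_sdH -cardsT.
rewrite -(sdprod_card (sdprod_sdpair to)).
rewrite (card_injm (injm_sdpair1 _)) // (card_injm (injm_sdpair2 _)) //.
by rewrite cardsT card_ord muln2 addnn.
Qed.

Lemma sdx_notin_sdH : x \notin K.
Proof.
have [_ _ _ tiK] := sdprodP (sdprod_sdpair to).
apply/negP=> Kx; have : x \in K :&: sdpair2 to @* [set: 'Z_2].
  by rewrite inE Kx mem_morphim ?inE.
rewrite tiK => /set1P x1.
(* The right-hand [1] is the neutral element of the additive group ['Z_2], so on values this reads 1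
   = 0. *)
suff /(congr1 val): (1%R : 'Z_2) = 1 by [].
by apply: (injmP (injm_sdpair2 to)); rewrite ?inE // morph1.
Qed.

Lemma sdH_mul_sdx_notin h : h \in H -> sdpair1 to h * x \notin K.
Proof.
by move=> Hh; rewrite groupMl ?sdx_notin_sdH // mem_morphim.
Qed.

End SemidirectZ2.

Theorem theorem10p8 (gT : finGroupType) (H : {group gT}) (sigma : {perm gT})
    (AutHsigma : sigma \in Aut H) (sigma2 : sigma ^+ 2 = 1) :
  G_TF AutHsigma sigma2 = #|H| ->
  exists k : nat, H \isog [set: 'rV['Z_2]_k] /\ sigma = 1.
Proof.
move=> cardS; pose S := S_TF AutHsigma sigma2.
pose x := sdx AutHsigma sigma2; pose K := sdH AutHsigma sigma2.
set i := sdpair1 (theta_gact AutHsigma sigma2).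
have sSK : S \subset ~: K.
  by apply/subsetP=> g; rewrite !inE => /andP[].
(* The inequalities [#|H| <= #|S| <= #|~: K| = #|H|] collapse; the same count is then the equality
   case needed for centrality of [S]. *)
have leHS : #|H| <= #|S| by rewrite -cardS card_classes_sub.
have defS : S = ~: K by apply/eqP; rewrite eqEcard sSK card_sdHC.
have cS : S \subset 'C([set: sdHZ2 AutHsigma sigma2]).
  by apply: classes_sub_cent; rewrite [leqRHS]cardS defS card_sdHC.
have Sx : x \in S by rewrite defS inE sdx_notin_sdH.
have Shx h : h \in H -> i h * x \in S.
  by move=> Hh; rewrite defS inE sdH_mul_sdx_notin.
have invS g : g \in S -> g ^+ 2 = 1 by rewrite inE => /andP[_ /eqP].
have x2 : x * x = 1 by apply: invS.
have comS g y : g \in S -> commute g y.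
  by move=> Sg; apply: (centP (subsetP cS g Sg)); rewrite inE.
have i_inj : {in H &, injective i} by apply/injmP/injm_sdpair1.
have iM : {in H &, {morph i : g h / g * h}} by apply: morphM.
have i1 : i 1 = 1 by apply: morph1.
have sigmaH h : h \in H -> sigma h = h.
  move=> Hh; apply: i_inj; rewrite ?Aut_closed //.
  rewrite /i -(sdx_conj AutHsigma sigma2 Hh) -/x (comS x) //.
  by rewrite -mulgA x2 mulg1.
have sigma1 : sigma = 1.
  (* [sigma] permutes all of [gT]; outside [H] it is the identity because members of [Aut H] fix
     every point there. *)
  apply/permP=> h; rewrite perm1; have [/sigmaH // | notHh] := boolP (h \in H).
  exact: out_Aut AutHsigma notHh.
(* Both factors [i h * x] and [x] lie in [S], hence are central involutions. So the square of [i h]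
   splits into trivial squares, and [i h] commutes with everything. *)
have iE h : i h = (i h * x) * x by rewrite -mulgA x2 mulg1.
have H2 h : h \in H -> h ^+ 2 = 1.
  move=> Hh; apply: i_inj; rewrite ?groupX // i1 [LHS]iM // iE -expg2.
  by rewrite (expgMn 2 (comS _ x (Shx h Hh))) !invS ?mulg1 ?Shx.
have abelH : 2.-abelem H.
  rewrite abelemE //; apply/andP; split; last by apply/exponentP.
  apply/centsP=> g Hg h Hh; apply: i_inj; rewrite ?groupM // !iM // iE.
  apply/commute_sym/commuteM; apply/commute_sym/comS => //; exact: Shx.
(* The exponent is the dimension of [H] over the field with two elements; elementary abelian
   2-groups of equal order are isomorphic. *)
exists (logn 2 #|H|); split=> //.
rewrite (isog_abelem_card _ abelH); apply/andP; split.
  exact: (mx_Fp_abelem 1 (logn 2 #|H|) (isT : prime 2)).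
by rewrite cardsT card_mx card_ord mul1n -(card_pgroup (abelem_pgroup abelH)).
Qed.
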